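(* Let $(A,\rho)$ be an object of $\mathbf{Preord}$ and let $\sim$ be an equivalence relation on $A$ contained in $\rho$. Then $$(A,\sim)\xrightarrow{\ k\ }(A,\rho)\xrightarrow{\ \pi\ }(A/\!\sim,\rho)$$ is a short preexact sequence in $\mathbf{Preord}$, where $k$ is the identity mapping and $\pi$ is the canonical projection. In particular, if $\simeq_\rho$ denotes the equivalence relation on $A$ defined by $a\simeq_\rho b$ if $a\rho b$ and $b\rho a$, and $\le_\rho$ is the partial order induced by $\rho$ on $A/\!\simeq_\rho$, then $$(A,\simeq_\rho)\xrightarrow{\ k\ }(A,\rho)\xrightarrow{\ \pi\ }(A/\!\simeq_\rho,\le_\rho)$$ is a short preexact sequence in $\mathbf{Preord}$.
   Context: $\mathbf{Preord}$ is the category whose objects are pairs $(A,\rho)$ with $A$ a non-empty set and $\rho$ a preorder (reflexive, transitive relation) on $A$, and whose morphisms are the preorder-preserving maps. When $\sim$ is an equivalence relation with $\sim\,\subseteq\rho$, the preorder $\rho$ induces a well defined preorder on $A/\!\sim$, still denoted $\rho$, given by $[a_1]_\sim\,\rho\,[a_2]_\sim$ if $a_1\rho a_2$; likewise $[a]_{\simeq_\rho}\le_\rho[b]_{\simeq_\rho}$ if $a\rho b$. A trivial object is an object $(B,=)$ with $=$ the equality relation; a morphism is trivial if it factors through a trivial object. A morphism $k\colon X\to A$ is a prekernel of $f\colon A\to A'$ if $fk$ is trivial and, whenever $\lambda\colon Y\to A$ is a morphism with $f\lambda$ trivial, there is a unique morphism $\lambda'\colon Y\to X$ with $\lambda=k\lambda'$.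 A morphism $p\colon A'\to X$ is a precokernel of $f\colon A\to A'$ if $pf$ is trivial and, whenever $\lambda\colon A'\to Y$ is a morphism with $\lambda f$ trivial, there is a unique morphism $\lambda_1\colon X\to Y$ with $\lambda=\lambda_1p$. A sequence $X\xrightarrow{f}Y\xrightarrow{g}Z$ is a short preexact sequence if $f$ is a prekernel of $g$ and $g$ is a precokernel of $f$. *)

(* Defs.v *)
From Stdlib Require Import Relation_Definitions RelationClasses.
From Stdlib Require Import FunctionalExtensionality PropExtensionality ProofIrrelevance.

(** * The category Preord *)

Record preord := Preord {
  carrier :> Type;
  rel : relation carrier;
  carrier_inhabited : inhabited carrier;
  rel_preorder : PreOrder rel
}.

Record hom (A B : preord) := Hom {
  hom_fun :> A -> B;
  hom_mono : forall x y : A, rel A x y -> rel B (hom_fun x) (hom_fun y)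
}.

Arguments Hom {A B} _ _.
Arguments hom_fun {A B} _ _.
Arguments hom_mono {A B} _ _ _ _.

(** Leibniz equality of morphisms is equality of the underlying maps. *)
Lemma hom_eq (A B : preord) (f g : hom A B) : (forall x, f x = g x) -> f = g.
Proof.
  destruct f as [f hf], g as [g hg]; simpl; intros H.
  assert (E : f = g) by (apply functional_extensionality; exact H).
  subst g; f_equal; apply proof_irrelevance.
Qed.

Definition id_hom (A : preord) : hom A A :=
  Hom (fun x => x) (fun x y h => h).

Definition comp {A B C : preord} (g : hom B C) (f : hom A B) : hom A C :=
  Hom (fun x => g (f x)) (fun x y h => hom_mono g _ _ (hom_mono f _ _ h)).

(** * Short preexact sequences *)

Definition trivial_obj (B : preord) : Prop :=
  forall x y : B, rel B x y <-> x = y.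

Definition trivial_hom {A C : preord} (f : hom A C) : Prop :=
  exists (B : preord) (h : hom A B) (g : hom B C),
    trivial_obj B /\ f = comp g h.

Definition is_prekernel {X A A' : preord} (k : hom X A) (f : hom A A') : Prop :=
  trivial_hom (comp f k) /\
  forall (Y : preord) (l : hom Y A), trivial_hom (comp f l) ->
    exists! l' : hom Y X, l = comp k l'.

Definition is_precokernel {A A' X : preord} (p : hom A' X) (f : hom A A') : Prop :=
  trivial_hom (comp p f) /\
  forall (Y : preord) (l : hom A' Y), trivial_hom (comp l f) ->
    exists! l1 : hom X Y, l = comp l1 p.

Definition short_preexact {X Y Z : preord} (f : hom X Y) (g : hom Y Z) : Prop :=
  is_prekernel f g /\ is_precokernel g f.

(** * Quotient sets *)

(** The elements of [A/~] are the equivalence classes themselves, as subsets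
    of [A]. *)
Definition quotient {A : Type} (E : relation A) : Type :=
  { X : A -> Prop | exists a : A, X = (fun b => E a b) }.

Definition class {A : Type} (E : relation A) (a : A) : quotient E :=
  exist _ (fun b => E a b) (ex_intro _ a eq_refl).

Lemma class_surj {A : Type} (E : relation A) (x : quotient E) :
  exists a, x = class E a.
Proof.
  destruct x as [X [a ->]]; exists a.
  unfold class; f_equal.
Qed.

Lemma class_eq {A : Type} (E : relation A) (HE : Equivalence E) (a b : A) :
  class E a = class E b <-> E a b.
Proof.
  split.
  - intros H; apply (f_equal (fun x => proj1_sig x b)) in H; simpl in H.
    rewrite H; reflexivity.
  - intros H; apply eq_sig_hprop; [intros; apply proof_irrelevance | simpl].
    apply functional_extensionality; intros c.
    apply propositional_extensionality; split; intros Hc.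
    + transitivity a; [symmetry |]; assumption.
    + transitivity b; assumption.
Qed.

Definition quotient_rel {A : Type} (R E : relation A) : relation (quotient E) :=
  fun x y => exists a b : A, x = class E a /\ y = class E b /\ R a b.

(** The induced relation does not depend on the representatives. *)
Lemma quotient_rel_class {A : Type} (R E : relation A) (HR : PreOrder R)
    (HE : Equivalence E) (HER : inclusion A E R) (a b : A) :
  quotient_rel R E (class E a) (class E b) <-> R a b.
Proof.
  split.
  - intros (a' & b' & Ha & Hb & H).
    apply (class_eq E HE) in Ha; apply (class_eq E HE) in Hb.
    transitivity a'; [apply HER; assumption |].
    transitivity b'; [assumption | apply HER; symmetry; assumption].
  - intros H; exists a, b; auto.
Qed.

Lemma quotient_rel_preorder {A : Type} (R E : relation A) (HR : PreOrder R)
    (HE : Equivalence E) (HER : inclusion A E R) : PreOrder (quotient_rel R E).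
Proof.
  split.
  - intros x; destruct (class_surj E x) as [a ->].
    apply (quotient_rel_class R E HR HE HER); reflexivity.
  - intros x y z.
    destruct (class_surj E x) as [a ->], (class_surj E y) as [b ->],
      (class_surj E z) as [c ->].
    rewrite !(quotient_rel_class R E HR HE HER).
    intros; transitivity b; assumption.
Qed.

Lemma quotient_inhabited {A : Type} (E : relation A) :
  inhabited A -> inhabited (quotient E).
Proof. intros [a]; exact (inhabits (class E a)). Qed.

(** * The sequence attached to an equivalence relation contained in a preorder *)

(** [(A, ~)] *)
Definition equiv_obj (A : preord) (E : relation A) (HE : Equivalence E) : preord :=
  Preord A E (carrier_inhabited A) (Equivalence_PreOrder HE).

(** [(A/~, rho)] *)
Definition quotient_obj (A : preord) (E : relation A) (HE : Equivalence E)
    (HER : inclusion A E (rel A)) : preord :=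
  Preord (quotient E) (quotient_rel (rel A) E)
    (quotient_inhabited E (carrier_inhabited A))
    (quotient_rel_preorder (rel A) E (rel_preorder A) HE HER).

Definition identity_map (A : preord) (E : relation A) (HE : Equivalence E)
    (HER : inclusion A E (rel A)) : hom (equiv_obj A E HE) A :=
  @Hom (equiv_obj A E HE) A (fun a => a) HER.

Definition projection (A : preord) (E : relation A) (HE : Equivalence E)
    (HER : inclusion A E (rel A)) : hom A (quotient_obj A E HE HER) :=
  @Hom A (quotient_obj A E HE HER) (class E)
    (fun a b h => ex_intro _ a (ex_intro _ b (conj eq_refl (conj eq_refl h)))).

(** * The equivalence relation attached to a preorder *)

Definition simeq (A : preord) : relation A :=
  fun a b => rel A a b /\ rel A b a.

Lemma simeq_equivalence (A : preord) : Equivalence (simeq A).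
Proof.
  pose proof (rel_preorder A) as HR; split.
  - intros a; split; reflexivity.
  - intros a b [H1 H2]; split; assumption.
  - intros a b c [H1 H2] [H3 H4]; split; transitivity b; assumption.
Qed.

Lemma simeq_incl (A : preord) : inclusion A (simeq A) (rel A).
Proof. intros a b [H _]; exact H. Qed.

(** [(A/simeq, <=)] is a partially ordered set. *)
Lemma quotient_simeq_order (A : preord) :
  order _ (rel (quotient_obj A (simeq A) (simeq_equivalence A) (simeq_incl A))).
Proof.
  pose proof (rel_preorder (quotient_obj A (simeq A) (simeq_equivalence A)
    (simeq_incl A))) as [Hr Ht].
  split; [exact Hr | exact Ht |].
  intros x y; simpl.
  destruct (class_surj _ x) as [a ->], (class_surj _ y) as [b ->].
  rewrite !(quotient_rel_class (rel A) (simeq A) (rel_preorder A)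
    (simeq_equivalence A) (simeq_incl A)).
  intros H1 H2; apply (class_eq _ (simeq_equivalence A)); split; assumption.
Qed.

(* Main.v *)
Require Import Defs.
From Stdlib Require Import Relation_Definitions RelationClasses.
From Stdlib Require Import IndefiniteDescription.

(** A morphism is trivial exactly when it identifies any two related elements
    ([trivial_hom_iff]), so both universal properties become statements about
    relations. The map [projection] identifies precisely the pairs related by
    [E]; hence [l] composed with it is trivial if and only if [l] sends related
    elements to [E]-related ones, that is, [l] is already monotone into [(A, E)].
    Dually, [l] composed with [identity_map] is trivial if and only if [l] is
    constant on the classes of [E], that is, [l] descends to the quotient.
    Uniqueness holds because the identity is injective and the projection
    surjective. The second sequence is the case where [E] is [simeq A]. *)

Definition discrete (C : preord) : preord :=
  Preord C eq (carrier_inhabited C) (Equivalence_PreOrder eq_equivalence).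

Definition discrete_incl (C : preord) : hom (discrete C) C :=
  @Hom (discrete C) C (fun x => x)
    (fun x y e => match e in _ = z return rel C x z with
                  | eq_refl => @PreOrder_Reflexive _ _ (rel_preorder C) x
                  end).

(** A map that identifies related elements is monotone even for equality on its
    target, so it factors through the target made discrete. *)
Lemma trivial_hom_iff (A C : preord) (f : hom A C) :
  trivial_hom f <-> forall x y, rel A x y -> f x = f y.
Proof.
  split.
  - intros (B & h & g & HB & ->) x y Hxy; simpl.
    f_equal; apply HB, hom_mono, Hxy.
  - intros H.
    exists (discrete C), (@Hom A (discrete C) f H), (discrete_incl C).
    split; [intros x y; reflexivity |].
    apply hom_eq; reflexivity.
Qed.

Section Sequence.

Context (A : preord) (E : relation A) (HE : Equivalence E)
  (HER : inclusion A E (rel A)).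

Lemma projection_identity_trivial :
  trivial_hom (comp (projection A E HE HER) (identity_map A E HE HER)).
Proof.
  apply trivial_hom_iff; intros x y Hxy; simpl.
  apply (class_eq E HE), Hxy.
Qed.

Lemma identity_is_prekernel :
  is_prekernel (identity_map A E HE HER) (projection A E HE HER).
Proof.
  split; [exact projection_identity_trivial |].
  intros Y l Hl; rewrite trivial_hom_iff in Hl.
  assert (Hmono : forall x y, rel Y x y -> E (l x) (l y))
    by (intros x y Hxy; apply (class_eq E HE), (Hl x y Hxy)).
  exists (@Hom Y (equiv_obj A E HE) l Hmono); split.
  - apply hom_eq; reflexivity.
  - intros l' ->; apply hom_eq; reflexivity.
Qed.

(** A representative of each class is selected by choice; constancy on classes
    makes the value independent of the selection. *)
Lemma quotient_lift (Y : Type) (l : A -> Y) :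
  (forall a b, E a b -> l a = l b) ->
  exists f : quotient E -> Y, forall a, f (class E a) = l a.
Proof.
  intros Hl.
  pose (s x := constructive_indefinite_description _ (class_surj E x)).
  exists (fun x => l (proj1_sig (s x))); intros a.
  destruct (s (class E a)) as [b Hb]; simpl.
  symmetry; apply Hl, (class_eq E HE), Hb.
Qed.

Lemma projection_is_precokernel :
  is_precokernel (projection A E HE HER) (identity_map A E HE HER).
Proof.
  split; [exact projection_identity_trivial |].
  intros Y l Hl; rewrite trivial_hom_iff in Hl.
  destruct (quotient_lift Y l Hl) as [f Hf].
  assert (Hmono : forall x y, quotient_rel (rel A) E x y -> rel Y (f x) (f y)).
  { intros x y (a & b & -> & -> & Hab); rewrite !Hf.
    apply hom_mono, Hab. }
  exists (@Hom (quotient_obj A E HE HER) Y f Hmono); split.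
  - apply hom_eq; intros a; symmetry; apply Hf.
  - intros g ->; apply hom_eq; intros x.
    destruct (class_surj E x) as [a ->]; apply Hf.
Qed.

End Sequence.

Theorem mainTheorem2 (A : preord) :
  (forall (E : relation A) (HE : Equivalence E) (HER : inclusion A E (rel A)),
     short_preexact (identity_map A E HE HER) (projection A E HE HER))
  /\
  short_preexact
    (identity_map A (simeq A) (simeq_equivalence A) (simeq_incl A))
    (projection A (simeq A) (simeq_equivalence A) (simeq_incl A)).
Proof.
  split; [intros E HE HER |];
    split; auto using identity_is_prekernel, projection_is_precokernel.
Qed.
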